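(* Let $C_0>1$. There exist constants $C_1>1$ and $0<C_2<1$, depending only on $C_0$, such that the following holds. Let $d\ge 2$ and $n$ be integers with $1<\frac{n}{d-1}\le C_0$, and let $A$ be a $d\times n$ random matrix with i.i.d. standard Gaussian entries. Then with probability at least $1-nC_2^{d-1}$, \[ \min_{S\subseteq[n],\,|S|=d}\sigma_d(A_S)\ge\frac{1}{C_1^{d-1}}. \]
   Context: $A_S$ denotes the $d\times|S|$ submatrix of $A$ formed by the columns indexed by $S$, and $\sigma_d$ denotes the $d$-th largest singular value. *)

(* Defs.v *)
From HB Require Import structures.
From mathcomp Require Import all_boot all_order all_algebra.
From mathcomp Require Import all_classical all_reals all_analysis.
From mathcomp Require Import polyrcf.

Set Implicit Arguments.
Unset Strict Implicit.
Unset Printing Implicit Defensive.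

Import Order.TTheory GRing.Theory Num.Theory.

Local Open Scope classical_set_scope.
Local Open Scope ring_scope.

(* [rootsR] lists each real root once, so multiplicities are restored by [mup];
   only meaningful when all complex eigenvalues are real, e.g. for B = B^T. *)
Definition eigenvalues (R : realType) (n : nat) (B : 'M[R]_n) : seq R :=
  flatten [seq nseq (mup x (char_poly B)) x | x <- rootsR (char_poly B)].

Definition singular_values (R : realType) (m n : nat) (A : 'M[R]_(m, n)) :
    seq R :=
  sort >=%R [seq Num.sqrt x | x <- eigenvalues (A^T *m A)].

(* k is counted from 1. For an m x n matrix, [singular_values] has length n
   rather than minn m n: the extra entries are zeros at the end of the list,
   and [nth] also returns 0 beyond it. *)
Definition sigma (R : realType) (m n k : nat) (A : 'M[R]_(m, n)) : R :=
  nth 0 (singular_values A) k.-1.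

Definition column_submatrix (R : realType) (d n : nat) (A : 'M[R]_(d, n))
    (S : {set 'I_n}) : 'M[R]_(d, #|S|) :=
  colsub enum_val A.

Definition mutually_independent (disp : measure_display)
    (T : measurableType disp) (R : realType) (P : probability T R)
    (I : finType) (X : I -> {RV P >-> R}) : Prop :=
  forall (J : {set I}) (B : I -> set R),
    (forall i, measurable (B i)) ->
    P (\bigcap_(i in [set i | i \in J]) X i @^-1` B i) =
    (\prod_(i in J) P (X i @^-1` B i))%E.

Definition standard_gaussian (disp : measure_display)
    (T : measurableType disp) (R : realType) (P : probability T R)
    (X : {RV P >-> R}) : Prop :=
  forall B : set R, measurable B -> distribution P X B = normal_prob 0 1 B.

Definition iid_standard_gaussian_entries (disp : measure_display)
    (T : measurableType disp) (R : realType) (P : probability T R)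
    (d n : nat) (X : 'I_d -> 'I_n -> {RV P >-> R}) : Prop :=
  (forall i j, standard_gaussian (X i j)) /\
  mutually_independent (fun ij : 'I_d * 'I_n => X ij.1 ij.2).

Definition random_matrix (disp : measure_display)
    (T : measurableType disp) (R : realType) (P : probability T R)
    (d n : nat) (X : 'I_d -> 'I_n -> {RV P >-> R}) (w : T) : 'M[R]_(d, n) :=
  \matrix_(i, j) X i j w.

(* Main.v *)
(* Let M be the d x d matrix A_S. If t |cof_ij M| <= |det M| for all i, j and
   det M <> 0, then Cramer's rule bounds the entries of M^-1 by 1/t, so
   sigma_d(M) >= t/d. The determinant is affine in the single entry M_ij, with
   slope cof_ij M, and this slope and the constant term depend only on the other
   entries; as a Gaussian variable has density at most 1, each inequality fails
   with probability at most 3t. The factor 3 comes from replacing the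
   root -r/a by a cell of a grid of mesh t, which makes independence of events
   sufficient and avoids Fubini. It remains to take a union bound over (i, j)
   and over the at most 2^n <= 2^(C_0(d-1)) sets S. *)
Require Import Defs.
From HB Require Import structures.
From mathcomp Require Import all_boot all_order all_algebra.
From mathcomp Require Import polyrcf complex.
From mathcomp Require Import all_classical all_reals all_analysis.
From mathcomp Require Import measurable_realfun ring lra zify.

Set Implicit Arguments.
Unset Strict Implicit.
Unset Printing Implicit Defensive.

Import Order.TTheory GRing.Theory Num.Theory.

Local Open Scope classical_set_scope.
Local Open Scope ring_scope.

(** * Singular values *)

Lemma eigenvalues_splitting (R : realType) n (B : 'M[R]_n) (s : seq R) :
  char_poly B = \prod_(x <- s) ('X - x%:P) -> perm_eq (eigenvalues B) s.
Proof.
move=> Bs; rewrite -(permPr (perm_count_undup s)) /eigenvalues Bs.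
apply: (@perm_trans _ (flatten [seq nseq (count_mem x s) x
    | x <- rootsR (\prod_(x <- s) ('X - x%:P))])).
  by under eq_map do rewrite mu_prod_XsubC.
apply: perm_flatten; apply: perm_map; apply: uniq_perm.
- exact: uniq_roots.
- exact: undup_uniq.
move=> x; rewrite mem_undup -(root_prod_XsubC s).
by rewrite -(@roots_on_rootsR _ _ (monic_neq0 (monic_prod_XsubC _ _ _))) !inE.
Qed.


(** Over the complex numbers the matrix is hermitian, hence diagonalizable with a real spectrum; the
    factorization descends because the embedding of real polynomials is injective. *)
Lemma symmetric_char_poly_split (R : realType) n (B : 'M[R]_n) : B^T = B ->
  exists2 s : seq R, size s = n & char_poly B = \prod_(x <- s) ('X - x%:P).
Proof.
move=> BT; pose A := map_mx (real_complex R) B.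
have Ah : A \is hermsymmx.
  apply: realsym_hermsym; last first.
    by apply/mxOverP => i j; rewrite mxE complex_real.
  apply/is_hermitianmxP; rewrite expr0 scale1r map_mx_id //.
  by apply/matrixP => i j; rewrite !mxE -[in LHS]BT mxE.
have /hermitian_normalmx /orthomx_spectralP Aeq := Ah.
have /mxOverP sp_real := hermitian_spectral_diag_real Ah.
have P_unit := spectral_unit A.
move: Aeq sp_real P_unit; move: (spectralmx A) (spectral_diag A) => P D.
move=> Aeq sp_real P_unit.
exists [seq complex.Re (D 0 i) | i <- enum 'I_n].
  by rewrite size_map size_enum_ord.
apply: (map_inj_poly (@complexI R) (rmorph0 (real_complex R))).
rewrite map_char_poly -/A rmorph_prod big_map big_enum /=.
have -> : char_poly A = char_poly (diag_mx D).
  (* The similarity is lifted to polynomial matrices, where the scalar matrix ['X%:M] commutes with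
     the change of basis. *)
  pose Q := map_mx polyC P; pose Q' := map_mx polyC (invmx P).
  have QQ' : Q' *m Q = 1%:M by rewrite -map_mxM mulVmx// map_mx1.
  rewrite /char_poly.
  have -> : char_poly_mx A = Q' *m char_poly_mx (diag_mx D) *m Q.
    rewrite /char_poly_mx mulmxBr mulmxBl scalar_mxC -(mulmxA 'X%:M) QQ'.
    by rewrite mulmx1 -!map_mxM -Aeq.
  rewrite !det_mulmx mulrAC -det_mulmx QQ' det1 mul1r //.
rewrite char_poly_trig ?diag_mx_is_trig//; apply: eq_bigr => i _.
by rewrite rmorphB /= map_polyX map_polyC /= RRe_real// mxE eqxx.
Qed.

(** The decreasing list of singular values has length exactly d, so its d-th entry is its minimum;
    this trades the sorted list for a condition on roots. *)
Lemma sigma_geP (R : realType) d (B : 'M[R]_d) (c : R) : (0 < d)%N -> 0 < c ->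
  c <= sigma d B <->
  (forall x, root (char_poly (B^T *m B)) x -> c ^+ 2 <= x).
Proof.
move=> d_gt0 c_gt0; have Bsym : (B^T *m B)^T = B^T *m B.
  by rewrite trmx_mul trmxK.
have [s size_s Bs] := symmetric_char_poly_split Bsym.
have eig := eigenvalues_splitting Bs.
rewrite /sigma /singular_values; set t := sort _ _.
have size_t : size t = d by rewrite size_sort size_map (perm_size eig).
have t_sorted : sorted >=%R t by apply: sort_sorted => x y; exact: le_total.
have mem_t y : (y \in t) = (y \in [seq Num.sqrt x | x <- s]).
  by rewrite mem_sort; apply/perm_mem/perm_map.
(* For x < 0 the default value of [Num.sqrt] is 0, and c > 0 makes both sides false. *)
have sqrt_ge x : (c <= Num.sqrt x) = (c ^+ 2 <= x).
  have [x_ge0|x_lt0] := leP 0 x.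
    by rewrite -[in RHS](sqr_sqrtr x_ge0) ler_sqr ?nnegrE ?sqrtr_ge0 // ltW.
  rewrite ltr0_sqrtr// leNgt c_gt0; apply/esym/negbTE.
  by rewrite -ltNge (lt_le_trans x_lt0)// sqr_ge0.
split=> [c_le x|c_le].
  rewrite Bs root_prod_XsubC => xs; rewrite -sqrt_ge.
  have xt : Num.sqrt x \in t by rewrite mem_t map_f.
  apply: le_trans c_le _; rewrite -(nth_index 0 xt).
  have := sorted_leq_nth (rev_trans le_trans) (@lexx _ R) 0 t_sorted.
  apply; rewrite ?inE ?size_t ?prednK// -?size_t ?index_mem//.
  by rewrite -ltnS size_t prednK// -size_t index_mem.
have : nth 0 t d.-1 \in t by rewrite mem_nth// size_t prednK.
rewrite mem_t => /mapP[x xs ->]; rewrite sqrt_ge; apply: c_le.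
by rewrite Bs root_prod_XsubC.
Qed.

(** Cauchy-Schwarz against the all-ones vector, by summing (a_i - a_j)^2 >= 0 over all pairs. *)
Lemma sqr_sum_le (R : realFieldType) d (a : 'I_d -> R) :
  (\sum_i a i) ^+ 2 <= d%:R * \sum_i a i ^+ 2.
Proof.
have sum_const (b : R) : \sum_(j < d) b = d%:R * b.
  by rewrite sumr_const card_ord mulr_natl.
rewrite expr2 mulr_suml -(@ler_pM2l _ 2)//.
apply: (@le_trans _ _ (\sum_i \sum_j (a i ^+ 2 + a j ^+ 2))).
  rewrite mulr_sumr; apply: ler_sum => i _; rewrite mulr_sumr mulr_sumr.
  apply: ler_sum => j _; rewrite -subr_ge0.
  rewrite (_ : _ - _ = (a i - a j) ^+ 2) ?sqr_ge0//.
  by ring.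
under eq_bigr do rewrite big_split/= sum_const.
by rewrite big_split/= sum_const -mulr_sumr -mulr2n -[leLHS]mulr_natl.
Qed.

(** For a row eigenvector v of B^T B with eigenvalue x, the vector w = v B^T satisfies |w|^2 = x
    |v|^2, and v is recovered from w through the adjugate. The cofactor bounds give t |v_j| <=
    |w|_1; summing squares over j and comparing the l1 and l2 norms each cost a factor d, so t^2 <=
    d^2 x. *)
Lemma sigma_ge_cofactor (R : realType) d (B : 'M[R]_d) (t : R) : (0 < d)%N ->
  0 < t -> \det B != 0 -> (forall i j, t * `|cofactor B i j| <= `|\det B|) ->
  t / d%:R <= sigma d B.
Proof.
move=> d_gt0 t_gt0 det_neq0 cofactor_le.
have d_gt0' : 0 < d%:R :> R by rewrite ltr0n.
apply/sigma_geP => //; first by rewrite divr_gt0.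
move=> x; rewrite -eigenvalue_root_char => /eigenvalueP[v vB v_neq0].
pose w := v *m B^T; have wB : w *m B = x *: v by rewrite -mulmxA.
have dot (u : 'rV[R]_d) : (u *m u^T) 0 0 = \sum_j u 0 j ^+ 2.
  by rewrite mxE; apply: eq_bigr => j _; rewrite mxE.
have ww : \sum_j (w 0 j) ^+ 2 = x * \sum_j (v 0 j) ^+ 2.
  by rewrite -!dot [w^T]trmx_mul trmxK mulmxA wB -scalemxAl mxE.
have v_le j : t * `|v 0 j| <= \sum_i `|w 0 i|.
  rewrite -(@ler_pM2l _ `|\det B|) ?normr_gt0//.
  have vE : \det B * v 0 j = \sum_i w 0 i * cofactor B i j.
    have : (w *m \adj (B^T)) 0 j = (\det B *: v) 0 j.
      by rewrite -mulmxA mul_mx_adj mul_mx_scalar det_tr.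
    rewrite !mxE => <-; apply: eq_bigr => i _.
    by rewrite -trmx_adj !mxE.
  rewrite mulrCA -normrM vE mulrC mulr_sumr.
  apply: le_trans (ler_wpM2r (ltW t_gt0) (ler_norm_sum _ _ _)) _.
  rewrite mulr_suml; apply: ler_sum => i _; rewrite normrM -mulrA mulrC.
  by rewrite ler_wpM2r// mulrC.
have v_gt0 : 0 < \sum_j v 0 j ^+ 2.
  rewrite lt_def sumr_ge0 ?andbT => [|j _]; last exact: sqr_ge0.
  apply: contra_neq v_neq0 => v0; apply/rowP => j; rewrite mxE.
  apply/eqP; rewrite -sqrf_eq0; apply/eqP.
  by apply: (psumr_eq0P _ v0) => // i _; exact: sqr_ge0.
rewrite -(ler_pM2r v_gt0) -ww expr_div_n mulrAC ler_pdivrMr ?exprn_gt0//.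
rewrite mulr_sumr [leRHS]mulrC.
have -> : d%:R ^+ 2 * (\sum_j w 0 j ^+ 2) =
    \sum_(i < d) d%:R * \sum_j w 0 j ^+ 2.
  by rewrite sumr_const card_ord -[RHS]mulr_natl expr2 mulrA.
apply: ler_sum => j _; rewrite -(real_normK (num_real (v 0 j))) -exprMn.
apply: (@le_trans _ _ ((\sum_i `|w 0 i|) ^+ 2)).
  by rewrite lerXn2r ?nnegrE ?mulr_ge0 ?sumr_ge0// ltW.
apply: le_trans (sqr_sum_le _) _.
by under eq_bigr do rewrite real_normK ?num_real//.
Qed.

(* Countably many polynomial inequalities in the entries of B, which makes
   sigma_d measurable. *)
Lemma eigenvalues_ge_coef (R : realType) n (B : 'M[R]_n) (t : R) : B^T = B ->
  (forall x, root (char_poly B) x -> t <= x) <->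
  (forall i, 0 <= (char_poly (t%:M - B))`_i).
Proof.
move=> BT.
have shift x : root (char_poly (t%:M - B)) (t - x) = root (char_poly B) x.
  rewrite -!eigenvalue_root_char; apply/eigenvalueP/eigenvalueP.
    move=> [v vB v0]; exists v => //; move: vB.
    rewrite mulmxBr scalerBl mul_mx_scalar => /addrI /oppr_inj //.
  move=> [v vB v0]; exists v => //.
  by rewrite mulmxBr scalerBl mul_mx_scalar vB.
split=> [B_ge|coef_ge0 x].
  have tBT : (t%:M - B)^T = t%:M - B by rewrite linearB /= tr_scalar_mx BT.
  have [s _ sE] := symmetric_char_poly_split tBT.
  have : forall y, y \in s -> y <= 0.
    move=> y ys; rewrite -(subKr t y) subr_le0; apply: B_ge.
    by rewrite -shift subKr sE root_prod_XsubC.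
  (* A product of factors X - y with y <= 0 has nonnegative coefficients. *)
  rewrite sE; elim: s {sE} => [_ i|y s IHs ys i].
    by rewrite big_nil coef1.
  rewrite big_cons mulrBl coefB mul_polyC coefZ coefXM -mulNr.
  have IH := IHs (fun z zs => ys z (mem_behead (s := y :: s) zs)).
  rewrite addr_ge0 ?mulr_ge0 ?oppr_ge0 ?ys ?mem_head//.
  by case: ifP.
(* Conversely, a monic polynomial with nonnegative coefficients is positive on the positive axis, so
   t - x is not a positive root. *)
rewrite -shift leNgt => /rootP; apply: contra_eqN; rewrite -subr_gt0 => x_gt0.
rewrite horner_coef gt_eqF// size_char_poly big_ord_recr/=.
have := char_poly_monic (t%:M - B); rewrite monicE lead_coefE size_char_poly/=.
move=> /eqP ->; rewrite mul1r ltr_wpDl ?exprn_gt0// sumr_ge0// => i _.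
by rewrite mulr_ge0// exprn_ge0// ltW.
Qed.

(** * Measurability *)

Lemma measurable_bool_set disp (T : measurableType disp) (b : T -> bool) :
  measurable_fun setT b -> measurable [set w | b w].
Proof.
by move=> /(_ measurableT [set true]); rewrite setTI; apply.
Qed.

Lemma measurable_det disp (T : measurableType disp) (R : realType) d
    (B : T -> 'M[R]_d) :
  (forall i j, measurable_fun setT (fun w => B w i j)) ->
  measurable_fun setT (fun w => \det (B w)).
Proof.
move=> mB; apply: measurable_sum => s; apply: measurable_funM => //.
by apply: measurable_prod => i _; exact: mB.
Qed.

Definition measurable_coef disp (T : measurableType disp) (R : realType)
    (p : T -> {poly R}) : Prop :=
  forall i, measurable_fun setT (fun w => (p w)`_i).

Lemma measurable_coefM disp (T : measurableType disp) (R : realType)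
    (p q : T -> {poly R}) :
  measurable_coef p -> measurable_coef q ->
  measurable_coef (fun w => p w * q w).
Proof.
move=> mp mq i; under eq_fun do rewrite coefM.
by apply: measurable_sum => j; apply: measurable_funM.
Qed.

Lemma measurable_coef_char_poly disp (T : measurableType disp) (R : realType) d
    (B : T -> 'M[R]_d) :
  (forall i j, measurable_fun setT (fun w => B w i j)) ->
  measurable_coef (fun w => char_poly (B w)).
Proof.
move=> mB k; under eq_fun do rewrite /char_poly coef_sum.
apply: measurable_sum => s; move: k; apply: measurable_coefM.
  by move=> k; exact: measurable_cst.
have entry i j : measurable_coef (fun w => char_poly_mx (B w) i j).
  move=> k; under eq_fun do rewrite !mxE coefB coefC.
  apply: measurable_funB; first exact: measurable_cst.
  by case: (k == 0%N); [exact: mB|exact: measurable_cst].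
elim: (index_enum _) => [|i r IHr].
  by move=> k; under eq_fun do rewrite big_nil; exact: measurable_cst.
move=> k; under eq_fun do rewrite big_cons.
by move: k; exact: measurable_coefM.
Qed.

Lemma measurable_sigma_ge disp (T : measurableType disp) (R : realType) d
    (B : T -> 'M[R]_d) (c : R) : (0 < d)%N -> 0 < c ->
  (forall i j, measurable_fun setT (fun w => B w i j)) ->
  measurable [set w | c <= sigma d (B w)].
Proof.
move=> d_gt0 c_gt0 mB.
pose p w := char_poly ((c ^+ 2)%:M - (B w)^T *m B w).
have -> : [set w | c <= sigma d (B w)] = \bigcap_i [set w | 0 <= (p w)`_i].
  have sym w : ((B w)^T *m B w)^T = (B w)^T *m B w.
    by rewrite trmx_mul trmxK.
  apply/seteqP; split => w /=.
    move=> c_le i _; move: i; apply/eigenvalues_ge_coef => //.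
    exact/sigma_geP.
  move=> pw; apply/sigma_geP => //; apply/eigenvalues_ge_coef => // i.
  exact: pw.
have mp : measurable_coef p.
  apply: measurable_coef_char_poly => i j; under eq_fun do rewrite !mxE.
  apply: measurable_funB; first exact: measurable_cst.
  apply: measurable_sum => k; under eq_fun do rewrite !mxE.
  exact: measurable_funM.
apply: bigcap_measurableType => i _.
by apply: measurable_bool_set; exact: measurable_fun_ler.
Qed.

(** * Independence and anti-concentration *)

Lemma probability_union_bound disp (T : measurableType disp) (R : realType)
    (P : probability T R) (I : finType) (Q : pred I) (A : set T)
    (F : I -> set T) :
  measurable A -> (forall i, measurable (F i)) ->
  (forall w, A w -> exists2 i, Q i & F i w) ->
  (P A <= \sum_(i | Q i) P (F i))%E.
Proof.
move=> mA mF AF; pose U := \big[setU/set0]_(i | Q i) F i.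
have [mU PU] : measurable U /\ (P U <= \sum_(i | Q i) P (F i))%E.
  apply: (big_rec2 (fun V x => measurable V /\ (P V <= x)%E)).
    by rewrite measure0.
  move=> i x V Qi [mV PV]; split; first exact: measurableU.
  by apply: le_trans (measureU2 _ (mF i) mV) _; exact: leeD.
apply: le_trans PU; apply: le_measure; rewrite ?inE// => w /AF[i Qi Fi].
by rewrite /U -bigcup_seq_cond; exists i => //=; rewrite mem_index_enum.
Qed.

(** The density is at most its peak 1 / sqrt(2 pi), which is at most 1 because pi >= 2. *)
Lemma standard_gaussian_itv disp (T : measurableType disp) (R : realType)
    (P : probability T R) (Y : {RV P >-> R}) (a b : R) :
  standard_gaussian Y -> a <= b -> (P (Y @^-1` `[a, b]) <= (b - a)%:E)%E.
Proof.
move=> gY ab; have := gY `[a, b]%classic (measurable_itv _).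
rewrite /distribution /= /pushforward => ->.
rewrite /normal_prob.
apply: (@le_trans _ _
  (\int[lebesgue_measure]_(x in `[a, b]%classic) (cst 1%:E) x)%E).
  apply: ge0_le_integral => //=.
  - by move=> x _; rewrite lee_fin normal_pdf_ge0.
  - apply/measurable_EFinP; apply: measurable_funTS.
    exact: measurable_normal_pdf.
  move=> x _; rewrite lee_fin.
  apply: le_trans (normal_pdf_ub _ _ (oner_neq0 R)) _.
  rewrite /normal_peak invf_le1 ?sqrtr_gt0.
    rewrite -{1}sqrtr1 ler_sqrt// ?expr1n ?mul1r.
      by have := @pi_ge2 R; lra.
    by have := @pi_ge2 R; lra.
  by rewrite expr1n mul1r; have := @pi_ge2 R; lra.
rewrite integral_cst//= mul1e lebesgue_measure_itv /= lte_fin.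
by case: ifP => [_|_]; rewrite ?lee_fin ?subr_ge0// EFinB.
Qed.

Section Independence.
Context disp (T : measurableType disp) (R : realType) (P : probability T R).
Context (I : finType) (X : I -> {RV P >-> R}) (e : I).
Hypothesis indX : mutually_independent X.

(* A pi-system generating the sigma-algebra of the X i with i <> e. *)
Definition cylinders_away : set (set T) :=
  [set A | exists2 B : I -> set R, forall i, measurable (B i) &
    A = \bigcap_(i in [set i | i \in [set~ e]%SET]) X i @^-1` B i].

Lemma cylinders_away_setI : setI_closed cylinders_away.
Proof.
move=> _ _ [B mB ->] [B' mB' ->]; exists (fun i => B i `&` B' i).
  by move=> i; exact: measurableI.
by rewrite -bigcapI.
Qed.

Lemma cylinders_away_measurable : <<s cylinders_away >> `<=` measurable.
Proof.
apply: smallest_sub; first exact: sigma_algebra_measurable.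
move=> _ [B mB ->]; apply: fin_bigcap_measurable => // i _.
exact: measurable_funPTI.
Qed.

Lemma measurable_fun_away i : i != e ->
  measurable_fun (setT : set (g_sigma_algebraType cylinders_away)) (X i).
Proof.
move=> ie _ B mB; apply: sub_sigma_algebra.
exists (fun j => if j == i then B else setT) => [j|]; first by case: ifP.
rewrite setTI; apply/seteqP; split => w /= => [Bw j _|/(_ i)].
  by rewrite /preimage /=; case: eqP => [->|].
by rewrite /preimage /= eqxx !inE ie; apply.
Qed.

(** Dynkin's pi-lambda argument: the events independent of a fixed event form a Dynkin system, and
    this one contains the pi-system of cylinders. *)
Lemma independent_away (B : set R) A : measurable B ->
  <<s cylinders_away >> A ->
  P (X e @^-1` B `&` A) = (P (X e @^-1` B) * P A)%E.
Proof.
move=> mB; have mE : measurable (X e @^-1` B) by exact: measurable_funPTI.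
set E := X e @^-1` B in mE *; have PE_fin := fin_num_measure P E mE.
rewrite -(setI_closed_g_dynkin_g_sigma_algebra cylinders_away_setI).
suff H : <<d cylinders_away >> `<=`
    [set A | measurable A /\ P (E `&` A) = (P E * P A)%E].
  by move=> /H[].
apply: smallest_sub.
  split=> [|D [mD PD]|F tF mPF].
  - by split => //; rewrite setIT probability_setT mule1.
  - split; first exact: measurableC.
    rewrite -setDE.
    have -> : P (E `\` D) = (P E - P E * P D)%E.
      by rewrite -PD; apply: measureD; rewrite ?ge0_fin_numE// -ge0_fin_numE.
    by rewrite probability_setC// muleBr ?mule1 ?fin_num_adde_defr.
  have mF k : measurable (F k) by case: (mPF k).
  split; first exact: bigcupT_measurable.
  rewrite setI_bigcupr measure_semi_bigcup//.
  - rewrite measure_semi_bigcup//; last exact: bigcupT_measurable.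
    rewrite -[P E]fineK// -nneseriesZl//.
    by apply: eq_eseriesr => k _; rewrite fineK//; case: (mPF k).
  - by move=> k; exact: measurableI.
  - exact: trivIset_setIl.
  by apply: bigcupT_measurable => k; exact: measurableI.
move=> _ [C mC ->]; split.
  by apply: fin_bigcap_measurable => // i _; exact: measurable_funPTI.
(* Putting [B] at index e turns the intersection of E with the cylinder into a full cylinder. Mutual
   independence over all of I and over the complement of e then gives two products that differ by
   the factor P E. *)
pose C' i := if i == e then B else C i.
have mC' i : measurable (C' i) by rewrite /C'; case: ifP.
have := indX [set: I]%SET mC'; rewrite (bigD1 e)//= {2}/C' eqxx.
have -> : \bigcap_(i in [set i | i \in [set: I]%SET]) X i @^-1` C' i =
    E `&` \bigcap_(i in [set i | i \in [set~ e]%SET]) X i @^-1` C i.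
  apply/seteqP; split => w /=.
    move=> Cw; split.
      by have := Cw e; rewrite /C' eqxx; apply; rewrite /= inE.
    move=> i /=; rewrite !inE => ie; have := Cw i.
    by rewrite /C' (negbTE ie); apply; rewrite /= inE.
  move=> [Ew Cw] i _; rewrite /C' /preimage /=.
  by case: eqP => [->//|/eqP ie]; apply: Cw; rewrite /= !inE.
move=> ->; congr (_ * _)%E.
rewrite (indX [set~ e]%SET mC); apply: eq_big => i; first by rewrite !inE.
by rewrite /C' => /andP[_ /negbTE ->].
Qed.

End Independence.

Section SmallBall.
Context disp (T : measurableType disp) (R : realType) (P : probability T R).
Context (I : finType) (X : I -> {RV P >-> R}) (e : I).
Hypothesis indX : mutually_independent X.
(** Measurability with respect to [away] expresses dependence on the [X i] with i <> e only. *)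
Let away := g_sigma_algebraType (cylinders_away X e).

Lemma measurable_fun_from_away (a : T -> R) :
  measurable_fun (setT : set away) a -> measurable_fun setT a.
Proof.
move=> ma _ B mB; apply: (@cylinders_away_measurable _ _ _ _ _ X e).
exact: (ma measurableT B mB).
Qed.

(** After division by |a|, this says that [X e] lies within t of the root -r/a. The condition on a
    excludes points where a and r both vanish and the inequality holds trivially. *)
Let bad (a r : T -> R) (t : R) :=
  [set w | (a w != 0) && (`|X e w * a w + r w| <= t * `|a w|)].

Lemma measurable_affine_small (a r : T -> R) (t : R) :
  measurable_fun setT a -> measurable_fun setT r -> measurable (bad a r t).
Proof.
move=> ma mr.
have m1 : measurable_fun setT (fun w => a w == 0).
  by apply: measurable_fun_eqr => //; exact: measurable_cst.
have m2 : measurable_fun setT (fun w => `|X e w * a w + r w| <= t * `|a w|).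
  apply: measurable_fun_ler.
    apply: measurableT_comp => //; apply: measurable_funD => //.
    exact: measurable_funM.
  apply: measurable_funM; first exact: measurable_cst.
  exact: measurableT_comp.
apply: measurable_bool_set; apply: measurable_and => //.
exact: measurable_neg.
Qed.

(** When -r/a lies in the cell of index m, the bad event forces [X e] into [J m], an event
    independent of that cell and of probability at most 3t. The cells are disjoint, so summing over
    m gives at most 3t. *)
Lemma affine_small_ball (a r : T -> R) (t : R) : 0 < t ->
  standard_gaussian (X e) ->
  measurable_fun (setT : set away) a -> measurable_fun (setT : set away) r ->
  (P (bad a r t) <= (3 * t)%:E)%E.
Proof.
move=> t_gt0 gX ma mr.
(* The cells of the grid, in terms of -r/a, with denominators cleared. *)
pose strip (m : int) : set T := [set w | [&& a w != 0,
  m%:~R * t * a w ^+ 2 <= - r w * a w &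
  - r w * a w < (m%:~R + 1) * t * a w ^+ 2]].
(* The cell from mt to (m+1)t, enlarged by t on each side. *)
pose J (m : int) := `[(m%:~R - 1) * t, (m%:~R + 2) * t]%classic.
have mstrip m : <<s cylinders_away X e >> (strip m).
  apply: (@measurable_bool_set _ away); apply: measurable_and.
    apply: measurable_neg; exact: measurable_fun_eqr.
  have mra : measurable_fun (setT : set away) (fun w => - r w * a w).
    by apply: measurable_funM => //; exact: measurable_funN.
  have mca (c : R) : measurable_fun (setT : set away) (fun w => c * a w ^+ 2).
    by apply: measurable_funM; [exact: measurable_cst|exact: measurable_funX].
  apply: measurable_and; first exact: measurable_fun_ler.
  exact: measurable_fun_ltr.
(* Sigma-additivity wants indices in the naturals; those that encode no integer contribute the empty
   set. *)
pose F k := if @pickle_inv int k is Some m then strip m else set0.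
pose G k := if @pickle_inv int k is Some m then X e @^-1` J m else set0.
have mF k : <<s cylinders_away X e >> (F k).
  rewrite /F; case: pickle_inv => [m|]; first exact: mstrip.
  by have [] := smallest_sigma_algebra setT (cylinders_away X e).
have mF' k : measurable (F k) := cylinders_away_measurable (mF k).
have mJ m : measurable (J m) by exact: measurable_itv.
have mXJ m : measurable (X e @^-1` J m) by exact: measurable_funPTI.
have mG k : measurable (G k) by rewrite /G; case: pickle_inv.
have PGF k : (P (G k `&` F k) <= (3 * t)%:E * P (F k))%E.
  rewrite /G; case E: (pickle_inv k) => [m|]; last first.
    by rewrite set0I measure0 mule_ge0// lee_fin mulr_ge0// ltW.
  rewrite (independent_away indX (mJ m) (mF k)); apply: lee_wpmul2r => //.
  apply: le_trans (standard_gaussian_itv gX _) _.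
    by rewrite ler_pM2r// lerD2l; lra.
  by rewrite lee_fin -mulrBl; lra.
have tF : trivIset setT F.
  move=> i j _ _ [w []]; rewrite /F.
  case Ei: (pickle_inv i) => [m|//]; case Ej: (pickle_inv j) => [l|//].
  move=> /and3P[a0 m1 m2] /and3P[_ l1 l2].
  have a2_gt0 : 0 < t * a w ^+ 2 by rewrite mulr_gt0// exprn_even_gt0.
  suff ml : m = l.
    have := pickle_invK (T := int) i; have := pickle_invK (T := int) j.
    by rewrite Ei Ej ml /= => <- <-.
  move: (le_lt_trans m1 l2) (le_lt_trans l1 m2); rewrite -!mulrA !ltr_pM2r//.
  by rewrite -!intrD1 !ltr_int; lia.
have cover : bad a r t `<=` \bigcup_k (G k `&` F k).
  move=> w /andP[a0 small].
  (* The index of the cell that contains -r/a. *)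
  have [m mE] : exists m, m = Num.floor (- r w / a w / t) by eexists.
  exists (pickle m); first by split.
  rewrite /G /F pickleK_inv.
  have a2_gt0 : 0 < a w ^+ 2 by rewrite exprn_even_gt0.
  have zE : - r w / a w * a w ^+ 2 = - r w * a w by field.
  have /andP[m_le m_lt] := floor_itv (- r w / a w / t).
  rewrite -mE in m_le m_lt.
  rewrite ler_pdivlMr// in m_le; rewrite ltr_pdivrMr// intrD in m_lt.
  split; last first.
    by rewrite /strip /= a0 -zE ler_pM2r// ltr_pM2r// m_le.
  have : `|X e w - - r w / a w| <= t.
    rewrite -(@ler_pM2r _ `|a w|) ?normr_gt0// -normrM.
    rewrite (_ : (_ - _) * _ = X e w * a w + r w)//.
    by field.
  rewrite ler_norml => /andP[x_ge x_le].
  by rewrite /preimage /J /= in_itv /=; apply/andP; split; lra.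
have mbad : measurable (bad a r t).
  by apply: measurable_affine_small; exact: measurable_fun_from_away.
apply: (@le_trans _ _ (\sum_(k <oo) P (G k `&` F k))%E).
  by apply: measure_sigma_subadditive => // k; exact: measurableI.
apply: (@le_trans _ _ (\sum_(k <oo) ((3 * t)%:E * P (F k)))%E).
  by apply: lee_nneseries => // k _; exact: PGF.
rewrite nneseriesZl//.
rewrite -measure_semi_bigcup//; last exact: bigcupT_measurable.
rewrite -[leRHS]mule1; apply: lee_wpmul2l; first by rewrite lee_fin; lra.
by apply: probability_le1; exact: bigcupT_measurable.
Qed.

End SmallBall.

(** * Gaussian matrices *)

Section GaussianMatrix.
Context disp (T : measurableType disp) (R : realType) (P : probability T R).
Context (d n : nat) (X : 'I_d -> 'I_n -> {RV P >-> R}).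
Hypothesis gX : iid_standard_gaussian_entries X.

(** The cofactor is the slope of the determinant in the entry (i, j). Where it vanishes, the
    inequality t |cof| <= |det| is trivial, so those points are left out. *)
Definition near_singular k (M : T -> 'M[R]_k) (i j : 'I_k) (t : R) : set T :=
  [set w | (cofactor (M w) i j != 0) &&
           (`|\det (M w)| <= t * `|cofactor (M w) i j|)].

Lemma measurable_near_singular k (M : T -> 'M[R]_k) i j t :
  (forall i j, measurable_fun setT (fun w => M w i j)) ->
  measurable (near_singular M i j t).
Proof.
move=> mM; have mcof : measurable_fun setT (fun w => cofactor (M w) i j).
  apply: measurable_funM; first exact: measurable_cst.
  apply: measurable_det => p q; under eq_fun do rewrite !mxE.
  exact: mM.
apply: measurable_bool_set; apply: measurable_and.
  by apply: measurable_neg; exact: measurable_fun_eqr.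
apply: measurable_fun_ler; first exact/measurableT_comp/measurable_det.
by apply: measurable_funM => //; exact: measurableT_comp.
Qed.

(** With arbitrary row and column selections, deleting a row and a column yields a matrix of the
    same form, as the induction on the size in [probability_det_eq0] requires. *)
Let sub k (f : 'I_k -> 'I_d) (g : 'I_k -> 'I_n) w : 'M[R]_k :=
  mxsub f g (random_matrix X w).

Lemma measurable_random_submatrix k (f : 'I_k -> 'I_d) (g : 'I_k -> 'I_n) i j :
  measurable_fun setT (fun w => sub f g w i j).
Proof. by under eq_fun do rewrite !mxE; exact: measurable_funPT. Qed.
Hint Resolve measurable_random_submatrix : core.

(** Laplace expansion along row i writes the determinant as X_e cof_ij + r. The cofactors avoid row
    i and the remaining entries of that row avoid column j; injectivity of f and g ensures that none
    of these is again the entry e. *)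
Lemma probability_near_singular k (f : 'I_k -> 'I_d) (g : 'I_k -> 'I_n)
    (i j : 'I_k) (t : R) : injective f -> injective g -> 0 < t ->
  (P (near_singular (sub f g) i j t) <= (3 * t)%:E)%E.
Proof.
move=> f_inj g_inj t_gt0; case: gX => std ind.
pose Y (ij : 'I_d * 'I_n) := X ij.1 ij.2; pose e := (f i, g j).
pose away := g_sigma_algebraType (cylinders_away Y e).
pose a w := cofactor (sub f g w) i j.
pose r w := \sum_(l | l != j) sub f g w i l * cofactor (sub f g w) i l.
have mcof l : measurable_fun (setT : set away)
    (fun w => cofactor (sub f g w) i l).
  apply: measurable_funM; first exact: measurable_cst.
  apply: (@measurable_det _ away) => p q; under eq_fun do rewrite !mxE.
  apply: (@measurable_fun_away _ _ _ _ _ Y e (f (lift i p), g (lift l q))).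
  by rewrite xpair_eqE (inj_eq f_inj) eq_sym (negbTE (neq_lift _ _)).
have mr : measurable_fun (setT : set away) r.
  rewrite /r; under eq_fun do rewrite big_mkcond.
  apply: measurable_sum => l; case: (eqVneq l j) => lj /=.
    exact: measurable_cst.
  apply: measurable_funM => //; under eq_fun do rewrite !mxE.
  apply: (@measurable_fun_away _ _ _ _ _ Y e (f i, g l)).
  by rewrite xpair_eqE (inj_eq g_inj) (negbTE lj) andbF.
have := affine_small_ball (X := Y) (e := e) ind t_gt0 (std _ _) (mcof j) mr.
congr (P _ <= _)%E; apply: eq_set => w; congr (_ && (`|_| <= _)).
by rewrite (expand_det_row _ i) (bigD1 j)//= !mxE.
Qed.

(** Either the first minor vanishes, a null event by induction, or the cofactor is nonzero and a
    zero determinant lies in [near_singular] for every t > 0, whose probability is at most 3t. *)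
Lemma probability_det_eq0 k (f : 'I_k -> 'I_d) (g : 'I_k -> 'I_n) :
  injective f -> injective g -> P [set w | \det (sub f g w) == 0] = 0%E.
Proof.
elim: k f g => [|k IHk] f g f_inj g_inj.
  rewrite (_ : [set w | _] = set0) ?measure0//.
  by apply/seteqP; split => w //=; rewrite det_mx00 oner_eq0.
have mdet0 m f' g' : measurable [set w | \det (@sub m f' g' w) == 0].
  apply: measurable_bool_set; apply: measurable_fun_eqr => //.
  exact: measurable_det.
pose f' p := f (lift ord0 p); pose g' p := g (lift ord0 p).
have f'_inj : injective f' by move=> p q /f_inj /lift_inj.
have g'_inj : injective g' by move=> p q /g_inj /lift_inj.
have cofE w : cofactor (sub f g w) ord0 ord0 = \det (sub f' g' w).
  rewrite /cofactor expr0 mul1r; congr (\det _).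
  by apply/matrixP => p q; rewrite !mxE.
apply/eqP; rewrite eq_le measure_ge0 andbT.
apply/lee_addgt0Pr => t t_gt0; rewrite add0e.
have t3_gt0 : 0 < t / 3 by rewrite divr_gt0.
have := probability_near_singular ord0 ord0 f_inj g_inj t3_gt0.
rewrite (mulrC 3) divfK//; apply: le_trans.
rewrite -[leRHS]add0e -[X in (X + _)%E](IHk f' g' f'_inj g'_inj).
apply: le_trans (measureU2 _ _ _) => //; last exact: measurable_near_singular.
apply: le_measure; rewrite ?inE//.
  by apply: measurableU => //; exact: measurable_near_singular.
move=> w /= det0; rewrite /near_singular /= cofE.
case: (eqVneq (\det (sub f' g' w)) 0) => cof0; [by left|right => /=].
by rewrite (eqP det0) normr0 mulr_ge0// ltW.
Qed.

(** The choice t = c d makes the bound t / d of [sigma_ge_cofactor] equal to c; the d^2 pairs (i, j)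
    then contribute 3t each. *)
Lemma probability_sigma_small (g : 'I_d -> 'I_n) (c : R) : (0 < d)%N ->
  injective g -> 0 < c ->
  (P [set w | ~~ (c <= sigma d (colsub g (random_matrix X w)))%R] <=
   (3 * d%:R ^+ 3 * c)%:E)%E.
Proof.
move=> d_gt0 g_inj c_gt0; pose t := c * d%:R.
have d_gt0' : 0 < d%:R :> R by rewrite ltr0n.
have t_gt0 : 0 < t by rewrite mulr_gt0.
have id_inj : injective (@id 'I_d) by [].
pose M := sub id g.
have mM i j : measurable_fun setT (fun w => M w i j).
  exact: measurable_random_submatrix.
pose Z := [set w | \det (M w) == 0].
(* [None] stands for the null event that the matrix is singular. *)
pose F (o : option ('I_d * 'I_d)) :=
  if o is Some ij then near_singular M ij.1 ij.2 t else Z.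
have mZ : measurable Z.
  apply: measurable_bool_set; apply: measurable_fun_eqr => //.
  exact: measurable_det.
have mF o : measurable (F o).
  by case: o => [ij|] //; exact: measurable_near_singular.
have mA : measurable [set w | ~~ (c <= sigma d (M w))].
  rewrite (_ : [set w | _] = ~` [set w | c <= sigma d (M w)]).
    by apply: measurableC; exact: measurable_sigma_ge.
  by apply/seteqP; split => w /= /negP.
have cover w : ~~ (c <= sigma d (M w)) -> exists2 o, xpredT o & F o w.
  move=> sigma_lt; apply: contrapT => noF.
  have noF' o : ~ F o w by move=> Fo; apply: noF; exists o.
  have tE : t / d%:R = c by rewrite mulfK// gt_eqF.
  move/negP: sigma_lt; apply; rewrite -tE; apply: sigma_ge_cofactor => //.
    by apply/negP; exact: (noF' None).
  move=> i j; have /negP := noF' (Some (i, j)).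
  rewrite negb_and negbK => /orP[/eqP ->|].
    by rewrite normr0 mulr0.
  by rewrite -ltNge => /ltW.
apply: le_trans (probability_union_bound P mA mF cover) _.
rewrite (bigD1 None)//= probability_det_eq0// add0e.
apply: (@le_trans _ _
  (\sum_(o : option ('I_d * 'I_d) | o != None) (3 * t)%:E)%E).
  by apply: lee_sum => -[[i j]|//] _; exact: probability_near_singular.
rewrite sumEFin lee_fin sumr_const cardC1 card_option /= card_prod card_ord.
rewrite -[leLHS]mulr_natr natrM /t le_eqVlt; apply/orP; left; apply/eqP.
by ring.
Qed.

End GaussianMatrix.

(** * Union bound over the column sets *)

Lemma probability_column_sigma_small (disp : measure_display)
    (T : measurableType disp) (R : realType) (P : probability T R)
    (d n : nat) (X : 'I_d -> 'I_n -> {RV P >-> R}) (S : {set 'I_n}) (c : R) :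
  iid_standard_gaussian_entries X -> (0 < d)%N -> #|S| = d -> 0 < c ->
  let A := [set w | ~~ (c <= sigma d (column_submatrix (random_matrix X w) S))]
  in measurable A /\ (P A <= (3 * d%:R ^+ 3 * c)%:E)%E.
Proof.
(* The cardinal of S occurs in the type of the submatrix, so it is generalized together with its
   enumeration before being identified with d. *)
rewrite /column_submatrix => gX d_gt0; move: enum_val (@enum_val_inj _ (mem S)).
move: #|S| => m g g_inj md c_gt0; subst m; split.
  have -> : [set w | ~~ (c <= sigma d (colsub g (random_matrix X w)))] =
      ~` [set w | c <= sigma d (colsub g (random_matrix X w))].
    by apply/seteqP; split => w /= /negP.
  apply: measurableC; apply: measurable_sigma_ge => // i j.
  exact: measurable_random_submatrix.
exact: probability_sigma_small.
Qed.

(** One factor d is bounded by n, the other two by 2^(d-1) each, 3 by 3^(d-1), and 2^n by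
    2^(K(d-1)). *)
Lemma union_bound_numerics (K d n : nat) :
  (2 <= d)%N -> (d <= n)%N -> (n <= K * (d - 1))%N ->
  (2 ^ n * (3 * d ^ 3) <= n * (12 ^ (d - 1) * 2 ^ (K * (d - 1))))%N.
Proof.
case: d => [|[|m]]//= _ dn; rewrite subn1 /= => nK.
have d_le : (m.+2 <= 2 ^ m.+1)%N by exact: ltn_expl.
have -> : (3 * m.+2 ^ 3 = m.+2 * (3 * (m.+2 * m.+2)))%N.
  by rewrite !expnS expn0; lia.
rewrite mulnCA leq_mul// mulnC leq_mul ?leq_exp2l//.
rewrite (_ : 12 = 3 * (2 * 2))%N// !expnMn leq_mul ?leq_mul//.
by rewrite -[X in (X <= _)%N]expn1 leq_exp2l.
Qed.

Theorem theorem1p5 (R : realType) (C0 : R) (hC0 : 1 < C0) :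
  exists C1 C2 : R,
    [/\ 1 < C1, 0 < C2, C2 < 1 &
      forall (d n : nat),
        (2 <= d)%N ->
        1 < n%:R / (d - 1)%N%:R :> R ->
        n%:R / (d - 1)%N%:R <= C0 ->
      forall (disp : measure_display) (T : measurableType disp)
        (P : probability T R) (X : 'I_d -> 'I_n -> {RV P >-> R}),
        iid_standard_gaussian_entries X ->
        ((1 - n%:R * C2 ^+ (d - 1))%:E <=
         P [set w | (1 / C1 ^+ (d - 1))%:E <=
              \big[mine/+oo]_(S : {set 'I_n} | #|S| == d)
                 (sigma d (column_submatrix (random_matrix X w) S))%:E])%E].
Proof.
(* A natural number above C0, so that n <= K (d - 1). *)
pose K := (Num.truncn C0).+1.
have C0_lt : C0 < K%:R by apply: truncnS_gt; rewrite ?num_real.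
have K2_ge1 : 1 <= 2 ^+ K :> R by rewrite exprn_ege1// ler1n.
(* In 24 = 2 * 12, the 12 absorbs the polynomial factor 3 d^3 up to n, and the 2 leaves the decay C2
   = 1/2; 2^K pays for the number of sets S. *)
exists (24 * 2 ^+ K), (1 / 2); split; [lra|lra|lra|].
move=> d n d_ge2 n_gt n_le disp T P X gX.
have d_gt0 : (0 < d)%N by exact: ltnW.
have m_gt0 : 0 < (d - 1)%N%:R :> R by rewrite ltr0n subn_gt0.
rewrite ltr_pdivlMr// mul1r ltr_nat in n_gt.
have nK : (n <= K * (d - 1))%N.
  rewrite -(@ler_nat R) natrM -ler_pdivrMr//.
  exact: le_trans n_le (ltW C0_lt).
have dn : (d <= n)%N by lia.
set c := 1 / _ ^+ (d - 1).
have c_gt0 : 0 < c by rewrite divr_gt0// exprn_gt0//; lra.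
set E := [set w | _].
pose F (S : {set 'I_n}) := if #|S| == d then
  [set w | ~~ (c <= sigma d (column_submatrix (random_matrix X w) S))]
  else set0.
have mF S : measurable (F S).
  rewrite /F; case: eqP => // Sd.
  by case: (probability_column_sigma_small gX d_gt0 Sd c_gt0).
have PF (S : {set 'I_n}) : #|S| == d -> (P (F S) <= (3 * d%:R ^+ 3 * c)%:E)%E.
  move=> Sd; rewrite /F Sd.
  by case: (probability_column_sigma_small gX d_gt0 (eqP Sd) c_gt0).
have EC w : (~` E) w <-> exists2 S : {set 'I_n}, #|S| == d & F S w.
  rewrite /E /=; split.
    (* The minimum starts from [+oo], hence the extra trivial comparison in [bigmin_geP]. *)
    move=> notE; apply: contrapT => noF; apply: notE; apply/bigmin_geP.
    split=> [|S Sd]; first exact: leey.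
    rewrite lee_fin; apply: contrapT => /negP cS; apply: noF; exists S => //.
    by rewrite /F Sd.
  move=> [S Sd]; rewrite /F Sd /= => /negP cS /bigmin_geP[_ /(_ S Sd)].
  by rewrite lee_fin.
(* Writing the complement as a finite union makes it measurable, as both the union bound and the
   final passage to [P E] require. *)
have EU : ~` E = \big[setU/set0]_(S : {set 'I_n} | #|S| == d) F S.
  rewrite -bigcup_seq_cond; apply/seteqP; split => w.
    by move=> /EC[S Sd FS]; exists S => //=; rewrite mem_index_enum.
  by move=> [S /=]; rewrite mem_index_enum /= => Sd FS; apply/EC; exists S.
have mEC : measurable (~` E) by rewrite EU; exact: bigsetU_measurable.
have PEC : (P (~` E) <= (n%:R * (1 / 2) ^+ (d - 1))%:E)%E.
  apply: le_trans (probability_union_bound P mEC mF (fun w => (EC w).1)) _.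
  apply: le_trans (lee_sum _ PF) _.
  rewrite sumEFin lee_fin sumr_const.
  have C1E : (24 * 2 ^+ K) ^+ (d - 1) =
      (2 ^ (d - 1))%:R * (12 ^ (d - 1) * 2 ^ (K * (d - 1)))%:R :> R.
    by rewrite natrM !natrX exprM mulrA -!exprMn -natrM.
  have b_ge0 : 0 <= 3 * d%:R ^+ 3 * c.
    by rewrite mulr_ge0 ?mulr_ge0 ?exprn_ge0// ltW.
  (* The sets of size d are counted crudely by all 2^n subsets. *)
  apply: (@le_trans _ _ (3 * d%:R ^+ 3 * c *+ 2 ^ n)).
    rewrite ler_wpMn2l// (leq_trans (max_card _))//.
    by rewrite -cardsT -powersetT card_powerset cardsT card_ord.
  rewrite /c C1E mul1r invfM mulrA -mulrnAl -mulr_natr.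
  rewrite ler_pdivrMr ?ltr0n ?muln_gt0 ?expn_gt0// expr_div_n expr1n mul1r.
  rewrite natrX mulrAC [leRHS]mulrAC ler_pM2r ?invr_gt0 ?exprn_gt0//.
  rewrite -natrX -!natrM ler_nat mulnC.
  exact: union_bound_numerics.
have -> : P E = (1 - P (~` E))%E by rewrite -probability_setC// setCK.
by rewrite EFinB leeB.
Qed.
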